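(* Let $R$ be a Rickart *-ring with proper involution. Then $R$ is a lower semilattice under the star order $\preceq$ (i.e. every two elements have a greatest lower bound) if and only if $R$ admits a *-minus operation $\ominus$. If this is the case, then $(x\curlywedge y)+(x\ominus y)=x$ for all $x,y\in R$.
   Context: A *-ring is an associative ring $R$ with an involution $x\mapsto x^*$ (additive, $(xy)^*=y^*x^*$, $x^{**}=x$). A projection is an element $e$ with $e^2=e=e^*$. $R$ is a Rickart *-ring if the right annihilator of every element is generated by a projection, i.e. to each $x\in R$ there is a (necessarily unique) projection $x'$ such that for all $y\in R$: $xy=0$ iff $y=x'y$. Elements $x,y$ are *-orthogonal, $x\perp y$, if $xy^*=0=x^*y$. The involution is proper if $x^*x=0$ implies $x=0$. The star order on $R$ is the partial order defined by: $x\preceq y$ iff $x\perp y-x$; equivalently, $x^*x=x^*y$ and $xx^*=yx^*$. The symbol $\curlywedge$ denotes the meet (greatest lower bound) in $(R,\preceq)$. A *-minus (star minus) operation on $R$ is any binary operation $\ominus$ on $R$ such that for all $x,y\in R$: (a) $x-(x\ominus y)\preceq y$; (b) if $x\preceq y$, then $z\ominus y\preceq z\ominus x$ for every $z\in R$; (c) if $y\preceq x$, then $x\ominus y=x-y$. *)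

(* Defs.v *)
From HB Require Import structures.
From mathcomp Require Import all_boot all_algebra.

Set Implicit Arguments.
Unset Strict Implicit.
Unset Printing Implicit Defensive.

Import GRing.Theory.
Local Open Scope ring_scope.

(* An associative ring with involution. The ring structures of the library all
   carry a unit, which is not part of the notion of *-ring, so multiplication
   is added directly on top of an additive abelian group. *)
HB.mixin Record Zmodule_isStarRing R of GRing.Zmodule R := {
  smul : R -> R -> R;
  star : R -> R;
  smulA : associative smul;
  smulDl : left_distributive smul +%R;
  smulDr : right_distributive smul +%R;
  starD : {morph star : x y / x + y};
  starM : forall x y, star (smul x y) = smul (star y) (star x);
  starK : involutive star
}.

#[short(type="starRingType")]
HB.structure Definition StarRing :=
  { R of GRing.Zmodule R & Zmodule_isStarRing R }.

Declare Scope star_ring_scope.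
Delimit Scope star_ring_scope with SR.
Notation "x * y" := (smul x y) : star_ring_scope.
Notation "x ^*" := (star x) : star_ring_scope.
Local Open Scope star_ring_scope.

Definition projection (R : starRingType) (e : R) : Prop :=
  e * e = e /\ e = e^*.

Definition rickart (R : starRingType) : Prop :=
  forall x : R, exists x' : R,
    projection x' /\ forall y : R, x * y = 0 <-> y = x' * y.

Definition proper_star (R : starRingType) : Prop :=
  forall x : R, x^* * x = 0 -> x = 0.

Definition star_orth (R : starRingType) (x y : R) : Prop :=
  x * y^* = 0 /\ x^* * y = 0.

Definition star_le (R : starRingType) (x y : R) : Prop :=
  star_orth x (y - x).

Definition star_meet (R : starRingType) (x y m : R) : Prop :=
  [/\ star_le m x, star_le m y &
      forall z : R, star_le z x -> star_le z y -> star_le z m].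

Definition star_lower_semilattice (R : starRingType) : Prop :=
  forall x y : R, exists m : R, star_meet x y m.

Definition star_minus (R : starRingType) (sub : R -> R -> R) : Prop :=
  [/\ forall x y : R, star_le (x - sub x y) y,
      forall x y : R, star_le x y ->
        forall z : R, star_le (sub z y) (sub z x) &
      forall x y : R, star_le y x -> sub x y = x - y].

(* Main.v *)
Require Import Defs.
From mathcomp Require Import all_boot all_algebra.
From Stdlib Require Import ClassicalEpsilon.

(** The section of elements below a fixed [x] carries the order-reversing
involution [a |-> x - a].  A semilattice therefore gives the star minus operation
[x - (x meet y)].  Conversely, given a star minus operation [sub], put
[m := x - sub x y]: axiom (a) gives [m <= y], axiom (b) applied to [0 <= y] gives
[sub x y <= x], hence [m <= x], and axiom (b) applied to a common lower bound
[z <= y] gives [sub x y <= x - z], hence [z <= m].  All of this rests on one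
fact, a consequence of properness: what is orthogonal to [b] is orthogonal to
every [a <= b]. *)

Set Implicit Arguments.
Unset Strict Implicit.

Import GRing.Theory.
Local Open Scope ring_scope.

Section StarOrder.
Variable R : starRingType.
Implicit Types x y z a b m : R.
Local Open Scope star_ring_scope.

Lemma smul0r x : 0 * x = 0.
Proof. by apply: (addIr (0 * x)); rewrite -smulDl !add0r. Qed.

Lemma smulr0 x : x * 0 = 0.
Proof. by apply: (addIr (x * 0)); rewrite -smulDr !add0r. Qed.

Lemma smulrN x y : x * - y = - (x * y)%SR.
Proof. by apply: (addIr (x * y)); rewrite -smulDr !addNr smulr0. Qed.

Lemma smulBr x y z : x * (y - z) = (x * y)%SR - (x * z)%SR.
Proof. by rewrite smulDr smulrN. Qed.

Lemma smulBl x y z : (x - y) * z = (x * z)%SR - (y * z)%SR.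
Proof. by apply: (addIr (y * z)); rewrite -smulDl !subrK. Qed.

Lemma star0 : 0^* = 0 :> R.
Proof. by apply: (addIr (0^*)); rewrite -starD !add0r. Qed.

Lemma starN x : (- x)^* = - x^*%SR.
Proof. by apply: (addIr (x^*)); rewrite -starD !addNr star0. Qed.

Lemma starB x y : (x - y)^* = x^*%SR - y^*%SR.
Proof. by rewrite starD starN. Qed.

Lemma star_orth_sym x y : star_orth x y -> star_orth y x.
Proof.
case=> h1 h2; split.
- by rewrite -[y]starK -starM h1 star0.
- by rewrite -[x]starK -starM h2 star0.
Qed.

Lemma star_orth0 x : star_orth x 0.
Proof. by split; rewrite ?star0 smulr0. Qed.

Lemma star_orthD x y z : star_orth x y -> star_orth x z -> star_orth x (y + z).
Proof. by move=> [h1 h2] [h3 h4]; split; rewrite ?starD smulDr ?h1 ?h2 ?h3 ?h4 addr0. Qed.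

Lemma star_orthB x y z : star_orth x y -> star_orth x z -> star_orth x (y - z).
Proof. by move=> [h1 h2] [h3 h4]; split; rewrite ?starB smulBr ?h1 ?h2 ?h3 ?h4 subr0. Qed.

Lemma star_le_refl x : star_le x x.
Proof. by rewrite /star_le subrr; apply: star_orth0. Qed.

Lemma star_le0 x : star_le 0 x.
Proof. exact/star_orth_sym/star_orth0. Qed.

Lemma star_le_compl x y : star_le x y -> star_le (y - x) y.
Proof. by move=> h; rewrite /star_le subKr; apply: star_orth_sym. Qed.

Hypothesis hproper : proper_star R.

Lemma star_orth_le x a b : star_orth x b -> star_le a b -> star_orth x a.
Proof.
move=> [xb0 xsb0] /star_orth_sym[/eqP + /eqP].
rewrite starB !smulBl !subr_eq0 => /eqP baa /eqP bsa.
split.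
- suff /(congr1 (@star R)) : (x * a^*)^* = 0 by rewrite starK star0.
  apply: hproper; rewrite starK starM starK.
  by rewrite smulA -(smulA x) -bsa !smulA xb0 !smul0r.
- suff /(congr1 (@star R)) : a^* * x = 0 by rewrite starM starK star0.
  apply: hproper; rewrite starM starK.
  by rewrite smulA -(smulA _ a) -baa !smulA xsb0 !smul0r.
Qed.

Lemma star_le_trans a b x : star_le a b -> star_le b x -> star_le a x.
Proof.
(* Split [x - a] as [(b - a) + (x - b)]. *)
move=> hab hbx; rewrite /star_le -(subrKA b) addrC.
apply: (star_orthD hab); apply/star_orth_sym.
exact: star_orth_le (star_orth_sym hbx) hab.
Qed.

(** Each inequality kills one term of [(b - a)^* * (b - a)]. *)
Lemma star_le_anti a b : star_le a b -> star_le b a -> a = b.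
Proof.
move=> [_ hab] [_ hba]; apply/esym/eqP; rewrite -subr_eq0; apply/eqP.
apply: hproper; rewrite starB.
by rewrite smulBl hab subr0 -opprB smulrN hba oppr0.
Qed.

(** The difference of the complements is [b - a], and [x - b] is orthogonal to [b], hence to [a]. *)
Lemma star_le_compl_anti a b x :
  star_le a b -> star_le b x -> star_le (x - b) (x - a).
Proof.
move=> hab hbx; have xb := star_orth_sym hbx.
have -> : star_le (x - b) (x - a) = star_orth (x - b) (b - a).
  by rewrite /star_le opprB [b - x]addrC addrACA subrr add0r [- a + b]addrC.
exact: star_orthB xb (star_orth_le xb hab).
Qed.

Lemma star_meet_uniq x y m m' : star_meet x y m -> star_meet x y m' -> m = m'.
Proof.
move=> [mx my mmax] [mx' my' mmax'].
by apply: star_le_anti; [apply: mmax' | apply: mmax].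
Qed.

Lemma star_minus_meet (sub : R -> R -> R) :
  star_minus sub -> forall x y, star_meet x y (x - sub x y).
Proof.
move=> [subL subR subE] x y.
have subx z : star_le (sub x z) x.
  by have := subR _ _ (star_le0 z) x; rewrite (subE _ _ (star_le0 x)) subr0.
split=> [||z zx zy]; [exact/star_le_compl | exact: subL |].
(* With [z] written as [x - (x - z)], it remains to bound [sub x y] by [x - z], which is [sub x z]
   by axiom (c). *)
rewrite -[z](subKr x); apply: star_le_compl_anti (star_le_compl zx).
by rewrite -(subE _ _ zx); apply: subR.
Qed.

Lemma meet_star_minus (meet : R -> R -> R) :
  (forall x y, star_meet x y (meet x y)) ->
  star_minus (fun x y => x - meet x y).
Proof.
move=> meetP; split=> [x y|x y xy z|x y yx].
- by rewrite subKr; case: (meetP x y).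
- have [zyz _ zymax] := meetP z y; have [zxz zxx _] := meetP z x.
  (* The meet is monotone: [meet z x] lies below both [z] and [y]. *)
  by apply: star_le_compl_anti zyz; apply: zymax zxz (star_le_trans zxx xy).
- congr (_ - _); apply: star_meet_uniq (meetP x y) _.
  by split=> //; apply: star_le_refl.
Qed.

End StarOrder.

Theorem theorem5p5 (R : starRingType)
    (hR : rickart R) (hproper : proper_star R) :
  (star_lower_semilattice R <->
     exists sub : R -> R -> R, star_minus sub) /\
  (forall sub : R -> R -> R, star_minus sub ->
     forall x y m : R, star_meet x y m -> m + sub x y = x).
Proof.
split; first split.
- move=> meetR.
  (* Meets are only known to exist, so choice turns them into an operation. *)
  pose meet x y := proj1_sig (constructive_indefinite_description _ (meetR x y)).
  exists (fun x y => x - meet x y); apply: meet_star_minus => // x y.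
  exact: proj2_sig (constructive_indefinite_description _ (meetR x y)).
- by move=> [sub subP] x y; exists (x - sub x y); apply: star_minus_meet.
- move=> sub subP x y m mP.
  have := star_minus_meet hproper subP x y.
  by move=> /(star_meet_uniq hproper mP) ->; rewrite subrK.
Qed.
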